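(* Let $\alpha\in(0,1]$. Assume that $n_0$ is an even positive integer such that the polynomial $p_{n_0}$ has a positive root and its smallest positive root $r_{n_0}$ satisfies $$\frac{\Gamma(2n_0+6)}{\Gamma(2n_0+5-\alpha)}\ge r_{n_0}.$$ Then the function $p_\infty$ has a first (smallest) positive root, and this root lies in the open interval $(r_{n_0+1},r_{n_0})$.
   Context: For $\alpha\in(0,1]$ let $a_0:=1$ and $a_k:=\prod_{i=1}^{k}\frac{\Gamma(2i+1-\alpha)}{\Gamma(2i+2)}$ for $k\ge 1$, where $\Gamma$ is the Euler gamma function. For $n\in\mathbb{N}\cup\{\infty\}$ let $p_n(x)=\sum_{k=0}^{n}(-1)^k a_k x^k$, $x\in\mathbb{R}$ (for $n=\infty$ the power series converges absolutely on $\mathbb{R}$). For finite $n$, $r_n$ denotes the smallest positive root of $p_n$, whenever $p_n$ has a positive root; for odd $n$ a positive root always exists. *)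

(* Defs.v *)
From mathcomp Require Import all_boot all_order all_algebra.
From mathcomp Require Import all_classical all_reals all_analysis.

Set Implicit Arguments.
Unset Strict Implicit.
Unset Printing Implicit Defensive.
Import Order.TTheory GRing.Theory Num.Theory.
Import numFieldNormedType.Exports.
Local Open Scope classical_set_scope.
Local Open Scope ring_scope.

(* Euler's integral; it represents the gamma function for x > 0 only, and every
   argument used below is at least 2. *)
Definition Gamma (R : realType) (x : R) : R :=
  \int[@lebesgue_measure R]_(t in `]0, +oo[) (t `^ (x - 1) * expR (- t)).

(* The empty product gives a_0 = 1. *)
Definition acoef (R : realType) (alpha : R) (k : nat) : R :=
  \prod_(1 <= i < k.+1)
    (Gamma (2 * i%:R + 1 - alpha) / Gamma (2 * i%:R + 2)).

Definition scoef (R : realType) (alpha : R) (k : nat) : R :=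
  (-1) ^+ k * acoef alpha k.

Definition pfin (R : realType) (alpha : R) (n : nat) : {poly R} :=
  \poly_(k < n.+1) scoef alpha k.

Definition pinfty (R : realType) (alpha x : R) : R :=
  limn (pseries (scoef alpha) x).

Definition is_first_posroot (R : realType) (f : R -> R) (r : R) : Prop :=
  [/\ 0 < r, f r = 0 & forall x, 0 < x -> f x = 0 -> r <= x].

(* A polynomial with a positive root has a unique first one; the default value 0
   is taken only when there is no positive root. *)
Definition rfirst (R : realType) (alpha : R) (n : nat) : R :=
  xget 0 [set r | is_first_posroot (horner (pfin alpha n)) r].

(* Main.v *)
Require Import Defs.
From mathcomp Require Import all_boot all_order all_algebra.
From mathcomp Require Import all_classical all_reals all_analysis.
From mathcomp Require Import measurable_realfun exponential_distribution ring lra.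

Import Order.TTheory GRing.Theory Num.Theory.
Import numFieldNormedType.Exports.
Local Open Scope classical_set_scope.
Local Open Scope ring_scope.

(** Put [c_i = Gamma (2i+1-alpha) / Gamma (2i+2)], so that
    [a_(k+1) = a_k c_(k+1)].  The functional equation of Gamma shows that [c]
    is strictly decreasing, and the hypothesis says that [c_(n0+2) r <= 1],
    where [r] is the first positive root of [p_n0].  Hence for [0 < x <= r] the
    terms [a_k x^k] decrease from the index [n0+1] on, at a geometric rate from
    [n0+2] on, and the alternating series estimate gives
    [p_(n0+1)(x) < p_oo(x) < p_n0(x)].  So [p_oo] is positive up to the first
    root of [p_(n0+1)] and negative at [r], and it is continuous in between as
    a uniform limit of the [p_n]. *)

(** * The gamma integral: integrability, functional equation, positivity *)

Section gamma.
Set Implicit Arguments.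
Unset Strict Implicit.
Variable R : realType.
Implicit Types s t : R.
Let mu := @lebesgue_measure R.

(* This is [u <= exp u] at [u = t / (2 s)], raised to the power [s]. *)
Lemma gamma_integrand_le s t : 0 < s -> 0 <= t ->
  t `^ s * expR (- t) <= (2 * s) `^ s * expR (- (t / 2)).
Proof.
move=> s0 t0; have s20 : 0 < 2 * s by rewrite mulr_gt0.
rewrite [X in expR (- X)](_ : t = t / 2 + t / 2); last by field.
rewrite opprD expRD mulrA ler_wpM2r ?expR_ge0// expRN ler_pdivrMr ?expR_gt0//.
rewrite {1}(_ : t = 2 * s * (t / (2 * s))); last first.
  by rewrite mulrC divfK ?gt_eqF.
have u0 : 0 <= t / (2 * s) by rewrite divr_ge0// ltW.
rewrite powRM ?(ltW s20)// ler_wpM2l ?powR_ge0//.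
rewrite (_ : t / 2 = t / (2 * s) * s); last by field; rewrite gt_eqF.
rewrite expRM ge0_ler_powR ?nnegrE ?expR_ge0//; first exact: ltW.
by rewrite (le_trans _ (expR_ge1Dx _))// lerDr.
Qed.

Lemma within_continuous_powR s : 0 < s ->
  {within `[0, +oo[, continuous (fun t : R => t `^ s)}.
Proof.
move=> s0; apply/continuous_within_itvcyP; split.
  move=> t; rewrite in_itv/= andbT => t0.
  by apply/differentiable_continuous/derivable1_diffP/ex_derive/is_derive1_powR.
by rewrite powR0 ?gt_eqF//; exact: powR_cvg0.
Qed.

Lemma within_continuous_gamma_integrand s : 0 < s ->
  {within `[0, +oo[, continuous (fun t : R => t `^ s * expR (- t))}.
Proof.
move=> s0 t; apply: cvgM; first exact: within_continuous_powR.
apply: continuous_subspaceT => {}t.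
by apply: continuous_comp; [exact: opp_continuous|exact: continuous_expR].
Qed.

Lemma measurable_gamma_integrand s (D : set R) :
  measurable_fun D (fun t : R => t `^ s * expR (- t)).
Proof.
apply: measurable_funTS; apply: measurable_funM; first exact: measurable_powR.
by apply: measurableT_comp => //; exact: measurable_expR.
Qed.

(** The function is twice the density of the exponential law of rate 1/2. It dominates every gamma
    integrand below. *)
Lemma integrable_expR_half :
  mu.-integrable `]0, +oo[ (EFin \o (fun t : R => expR (- (t / 2)))).
Proof.
have /integrableS I := @integrable_exponential_pdf R 2^-1 ltac:(lra).
have {}I : mu.-integrable `]0, +oo[ (EFin \o exponential_pdf 2^-1).
  exact: I.
have := @integrableZl _ _ _ mu _ (measurable_itv _) 2 _ I.
apply: eq_integrable => // t; rewrite inE/= in_itv/= andbT => t0.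
rewrite exponential_pdfE ?ltW// -EFinM; congr (_%:E).
by rewrite mulrA mulfV// mul1r mulNr mulrC.
Qed.

Lemma integrable_gamma_integrand s : 0 < s ->
  mu.-integrable `]0, +oo[ (EFin \o (fun t : R => t `^ s * expR (- t))).
Proof.
move=> s0.
have := @integrableZl _ _ _ mu _ (measurable_itv _) ((2 * s) `^ s) _
  integrable_expR_half.
apply: le_integrable => //.
  by apply/measurable_EFinP; exact: measurable_gamma_integrand.
move=> t /=; rewrite in_itv/= andbT => t0.
rewrite lee_fin !ger0_norm ?mulr_ge0 ?powR_ge0 ?expR_ge0//.
by rewrite gamma_integrand_le// ltW.
Qed.

Lemma cvg_expR_half : expR (- (t / 2)) @[t --> +oo] --> (0 : R).
Proof.
apply: (@cvg_comp _ _ _ (fun t : R => t / 2) (fun t => expR (- t)) _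
  (pinfty_nbhs R)); last exact: cvgr_expR.
by apply: gt0_cvgMly => //; rewrite invr_gt0.
Qed.

Lemma cvg_gamma_integrand s : 0 < s ->
  t `^ s * expR (- t) @[t --> +oo] --> (0 : R).
Proof.
move=> s0.
apply: (@squeeze_cvgr _ _ _ _ (cst 0)
  (fun t => (2 * s) `^ s * expR (- (t / 2)))).
- near=> t; rewrite mulr_ge0 ?powR_ge0 ?expR_ge0//=.
  by rewrite gamma_integrand_le//; near: t; exact: nbhs_pinfty_ge.
- exact: cvg_cst.
- by rewrite -[X in _ --> X](mulr0 ((2 * s) `^ s)); apply: cvgMr; exact: cvg_expR_half.
Unshelve. all: by end_near. Qed.

Lemma within_continuous_expR_half :
  {within `[0, +oo[, continuous (fun t : R => expR (- (t / 2)))}.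
Proof.
apply: continuous_subspaceT => t.
apply: (@continuous_comp _ _ _ (fun t : R => - (t / 2)) (@expR R)).
  by apply: cvgN; apply: cvgMl; exact: cvg_id.
exact: continuous_expR.
Qed.

Lemma is_derive_expR_half t :
  is_derive t 1 (fun u : R => expR (- (u / 2))) (- (expR (- (t / 2)) / 2)).
Proof.
have D : is_derive t 1 (fun u : R => - (u / 2)) (- 2^-1).
  apply: is_deriveN; apply: is_derive_eq; rewrite /GRing.scale/=; ring.
have := @is_derive1_comp _ (@expR R) (fun u : R => - (u / 2)) t _ _ (is_derive_expR _) D.
by move=> /is_derive_eq; apply; rewrite mulrN.
Qed.

Lemma is_derive_gamma_integrand s t : 0 < t ->
  is_derive t 1 (fun u : R => u `^ (s + 1) * expR (- u))
    ((s + 1) * (t `^ s * expR (- t)) - t `^ (s + 1) * expR (- t)).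
Proof.
move=> t0.
have D1 := is_derive1_powR (s + 1) t0.
have D2 : is_derive t 1 (fun u : R => expR (- u)) (- expR (- t)).
  have D : is_derive t 1 (fun u : R => - u) (- 1) by apply: is_deriveN.
  have := @is_derive1_comp _ (@expR R) (fun u : R => - u) t _ _ (is_derive_expR _) D.
  by move=> /is_derive_eq; apply; rewrite mulrN mulr1.
have := is_deriveM D1 D2.
by move=> /is_derive_eq; apply; rewrite /GRing.scale/= addrK; ring.
Qed.

Lemma Rintegral_expR_half : \int[mu]_(t in `]0, +oo[) expR (- (t / 2)) = 2.
Proof.
rewrite Rintegral_itv_obnd_cbnd; last exact: integrable_expR_half.
rewrite (@Rintegral_ge0_continuous_FTC2y _ _ (fun t => - 2 * expR (- (t / 2))) 0 0).
- by rewrite mul0r oppr0 expR0; ring.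
- by move=> t _; exact: expR_ge0.
- exact: within_continuous_expR_half.
- by rewrite -[X in _ --> X](mulr0 (- 2)); apply: cvgMr; exact: cvg_expR_half.
- by move=> t _; apply: derivableM => //; apply: ex_derive; exact: is_derive_expR_half.
- apply: cvgMr; have := within_continuous_expR_half.
  by move=> /continuous_within_itvcyP[].
- move=> t _; have := is_deriveZ (-2) (is_derive_expR_half t).
  by rewrite derive1E => -[_ ->]; rewrite /GRing.scale/=; field.
Qed.

(** Integration by parts. With [x = s + 1], the condition [1 < x] makes [s] positive, so that both
    integrands are continuous up to 0. *)
Lemma GammaD1 (x : R) : 1 < x -> Gamma (x + 1) = x * Gamma x.
Proof.
rewrite -subr_gt0 -[in X in _ -> X](subrK 1 x); move: (x - 1) => s s0.
have s10 : 0 < s + 1 by rewrite addr_gt0.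
rewrite /Gamma !addrK -/mu.
set g0 := fun t => t `^ s * expR (- t).
set g1 := fun t => t `^ (s + 1) * expR (- t).
pose h t : R := expR (- (t / 2)).
(* Adding [K h] makes the derivative [g1 - (s + 1) g0] of [- g1] nonnegative,
   as the fundamental theorem of calculus on an unbounded interval requires. *)
pose K := (s + 1) * (2 * s) `^ s.
have I0 : mu.-integrable `]0, +oo[ (EFin \o g0) := integrable_gamma_integrand s0.
have I1 : mu.-integrable `]0, +oo[ (EFin \o g1) := integrable_gamma_integrand s10.
have Ih : mu.-integrable `]0, +oo[ (EFin \o h) := integrable_expR_half.
have Ig : mu.-integrable `]0, +oo[ (EFin \o (fun t => (s + 1) * g0 t)).
  exact: (@integrableZl _ _ _ mu _ (measurable_itv _) (s + 1) _ I0).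
have IK : mu.-integrable `]0, +oo[ (EFin \o (fun t => K * h t)).
  exact: (@integrableZl _ _ _ mu _ (measurable_itv _) K _ Ih).
have IB : mu.-integrable `]0, +oo[ (EFin \o (fun t => g1 t - (s + 1) * g0 t)).
  exact: (@integrableB _ _ _ mu _ _ _ _ I1 Ig).
have ID : mu.-integrable `]0, +oo[ (EFin \o (fun t => g1 t - (s + 1) * g0 t + K * h t)).
  exact: (@integrableD _ _ _ mu _ _ _ _ IB IK).
have Dg t : 0 < t -> is_derive t 1 g1 ((s + 1) * g0 t - g1 t).
  exact: is_derive_gamma_integrand.
(* [K * 2] is the integral of [K h], so this says that [g1 - (s + 1) g0] has integral 0. *)
suff : \int[mu]_(t in `]0, +oo[) (g1 t - (s + 1) * g0 t + K * h t) = K * 2.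
  rewrite RintegralD// RintegralZl// RintegralB// RintegralZl// Rintegral_expR_half.
  by move=> /(canRL (addrK _)); rewrite subrr => /eqP; rewrite subr_eq0 => /eqP.
rewrite Rintegral_itv_obnd_cbnd//.
(* The two zeros are the left endpoint and the limit of the antiderivative at infinity; its value at
   0 is [- (2 * K)]. *)
rewrite (@Rintegral_ge0_continuous_FTC2y _ _ (fun t => - (g1 t + 2 * K * h t)) 0 0).
- by rewrite /g1 /h powR0 ?gt_eqF// mul0r add0r mul0r oppr0 expR0; ring.
- move=> t t0; rewrite /K -!mulrA addrAC -addrA addr_ge0 ?mulr_ge0 ?powR_ge0 ?expR_ge0//.
  rewrite -mulrBr mulr_ge0 ?(ltW s10)// subr_ge0; exact: gamma_integrand_le.
- move=> t; apply: cvgD; [apply: cvgB|].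
  + exact: within_continuous_gamma_integrand.
  + by apply: cvgMr; exact: within_continuous_gamma_integrand.
  + by apply: cvgMr; exact: within_continuous_expR_half.
- rewrite -[X in _ --> X]oppr0; apply: cvgN.
  rewrite -[X in _ --> X]addr0; apply: cvgD; first exact: cvg_gamma_integrand.
  by rewrite -[X in _ --> X](mulr0 (2 * K)); apply: cvgMr; exact: cvg_expR_half.
- move=> t t0; apply/derivableN/derivableD; first by have [] := Dg _ t0.
  by apply: derivableM => //; apply: ex_derive; exact: is_derive_expR_half.
- apply: cvgN; apply: cvgD.
    by have /continuous_within_itvcyP[] := within_continuous_gamma_integrand s10.
  by apply: cvgMr; have /continuous_within_itvcyP[] := within_continuous_expR_half.
- move=> t; rewrite in_itv/= andbT => t0.
  have := is_deriveN (is_deriveD (Dg _ t0) (is_deriveZ (2 * K) (is_derive_expR_half t))).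
  by rewrite derive1E => -[_ ->]; rewrite /GRing.scale/= /h; field.
Qed.

Lemma GammaD2 (y : R) : 1 < y -> Gamma (y + 2) = (y + 1) * y * Gamma y.
Proof.
move=> y1; rewrite (_ : y + 2 = y + 1 + 1); last by ring.
by rewrite !GammaD1 ?mulrA//; lra.
Qed.

(** The nonnegative integrand is at least [expR (- 2)] on []1, 2]], an interval of length 1. *)
Lemma Gamma_gt0 (x : R) : 1 < x -> 0 < Gamma x.
Proof.
rewrite -subr_gt0 -[in X in _ -> X](subrK 1 x); move: (x - 1) => s s0.
rewrite /Gamma addrK -/mu.
apply: (@lt_le_trans _ _ (\int[mu]_(t in `]1, 2]) (expR (- 2)))).
  rewrite Rintegral_cst//= lebesgue_measure_itv/= lte_fin ltr1n -EFinB/=.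
  by rewrite mulr_gt0 ?expR_gt0//; lra.
have sub : `]1, 2] `<=` (`]0, +oo[ : set R).
  by move=> t /=; rewrite !in_itv/= andbT => /andP[t1 _]; rewrite (lt_trans _ t1).
have I : mu.-integrable `]1, 2] (EFin \o (fun t : R => t `^ s * expR (- t))).
  by apply: integrableS (integrable_gamma_integrand s0).
have le t : t \in `]1, 2] -> expR (- 2) <= t `^ s * expR (- t).
  rewrite in_itv/= => /andP[t1 t2].
  rewrite -[leLHS]mul1r ler_pM ?expR_ge0// ?ler_expR ?lerN2//.
  by rewrite -(powRr0 t) ler_powR ?ltW.
apply: (@le_trans _ _ (\int[mu]_(t in `]1, 2]) (t `^ s * expR (- t)))).
  apply: le_Rintegral => //.
  apply: (le_integrable _ _ _ I) => //.
    exact/measurable_EFinP.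
  move=> t tI; have let_ := le _ tI.
  by rewrite lee_fin !ger0_norm// ?expR_ge0// (le_trans _ let_)// expR_ge0.
rewrite /Rintegral fine_le//.
- exact: integrable_fin_num.
- by apply: integrable_fin_num => //; exact: integrable_gamma_integrand.
- apply: ge0_subset_integral => //.
    by apply/measurable_EFinP; exact: measurable_gamma_integrand.
  by move=> t _; rewrite lee_fin mulr_ge0 ?powR_ge0 ?expR_ge0.
Qed.

End gamma.

(** * Alternating series with geometrically decreasing terms *)

Section alternating_series.
Set Implicit Arguments.
Unset Strict Implicit.
Variable R : realType.
Implicit Types (u : R^nat) (q l x : R).

Lemma cvg_alt_series_shift u M l :
  series (fun k => (-1) ^+ k * u (M + k)%N) @ \oo --> l ->
  series (fun k => (-1) ^+ k * u k) @ \oo -->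
    \sum_(0 <= k < M) (-1) ^+ k * u k + (-1) ^+ M * l.
Proof.
move=> ul; rewrite -(cvg_shiftn M) /=.
under eq_cvg => n do
  rewrite /series/= (big_cat_nat (leq0n M) (leq_addl n M))/= -{2}[M]add0n
    big_addn addnK.
apply: cvgD; first exact: cvg_cst.
rewrite (_ : (fun n => _) =
    (fun n => (-1) ^+ M * series (fun k => (-1) ^+ k * u (M + k)%N) n)).
  exact: cvgMr.
apply/funext => n; rewrite /series/= mulr_sumr; apply: eq_bigr => k _.
by rewrite exprD mulrA [_ * (-1) ^+ M]mulrC [(k + M)%N]addnC.
Qed.

(** By induction for all [u] at once: the sum is [u 0] minus an alternating sum of the shifted
    sequence, which lies between 0 and [u 1]. *)
Lemma alt_sum_bound u n : (forall k, 0 <= u k) -> (forall k, u k.+1 <= u k) ->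
  0 <= \sum_(0 <= k < n) (-1) ^+ k * u k <= u 0%N.
Proof.
elim: n u => [|n IHn] u u0 ud; first by rewrite big_geq// lexx u0.
have /andP[h1 h2] := IHn (fun k => u k.+1) (fun k => u0 _) (fun k => ud _).
rewrite big_nat_recl// expr0 mul1r.
under eq_bigr do rewrite exprS mulN1r mulNr.
by rewrite sumrN subr_ge0 (le_trans h2)//= lerBlDr lerDl.
Qed.

(** Absolute convergence, by comparison with the geometric series of first term [u 0] and ratio
    [q]. *)
Lemma cvg_alt_series_geometric u q : 0 <= q < 1 -> (forall k, 0 <= u k) ->
  (forall k, u k.+1 <= q * u k) -> cvgn (series (fun k => (-1) ^+ k * u k)).
Proof.
move=> /andP[q0 q1] u0 uq; apply: normed_cvg.
apply: (@series_le_cvg _ _ (geometric (u 0%N) q)) => /=.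
- by move=> n; exact: normr_ge0.
- by move=> n; rewrite mulr_ge0// exprn_ge0.
- move=> n; rewrite normrM normrX normrN1 expr1n mul1r ger0_norm//.
  elim: n => [|n IHn]; first by rewrite expr0 mulr1.
  by rewrite (le_trans (uq n))// exprS mulrCA ler_wpM2l.
- by apply: is_cvg_geometric_series; rewrite ger0_norm.
Qed.

(** Passing to the limit in the finite bounds only gives weak inequalities. Let L, L', L'' be the
    sums for [u] and its first two shifts, so L = u_0 - L' and L' = u_1 - L''. Then L' <= u_1 < u_0
    gives L > 0, and L'' <= u_2 < u_1 gives L' > 0, that is L < u_0. *)
Lemma lim_alt_series_bound u q : 0 <= q < 1 -> (forall k, 0 < u k) ->
  (forall k, u k.+1 <= q * u k) ->
  0 < limn (series (fun k => (-1) ^+ k * u k)) < u 0%N.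
Proof.
move=> /[dup] q01 /andP[q0 q1] u0 uq.
have ud k : u k.+1 < u k by rewrite (le_lt_trans (uq k))// gtr_pMl.
have weak v : (forall k, 0 < v k) -> (forall k, v k.+1 <= q * v k) ->
    (forall k, v k.+1 < v k) ->
    0 <= limn (series (fun k => (-1) ^+ k * v k)) <= v 0%N.
  move=> v0 vq vd.
  have cv := cvg_alt_series_geometric q01 (fun k => ltW (v0 k)) vq.
  by apply/andP; split; [apply: limr_ge|apply: limr_le] => //; near=> n;
    have /andP[] := @alt_sum_bound v n (fun k => ltW (v0 k)) (fun k => ltW (vd k)).
have lim_recl v : (forall k, 0 < v k) -> (forall k, v k.+1 <= q * v k) ->
    limn (series (fun k => (-1) ^+ k * v k)) =
    v 0%N - limn (series (fun k => (-1) ^+ k * v k.+1)).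
  move=> v0 vq; apply/cvg_lim => //.
  have := @cvg_alt_series_shift v 1 (limn (series (fun k => (-1) ^+ k * v k.+1))).
  rewrite big_nat1 expr0 expr1 mul1r mulN1r; apply.
  exact: (cvg_alt_series_geometric q01 (fun k => ltW (v0 _))).
have /andP[_ h1] :=
  weak (fun k => u k.+1) (fun k => u0 _) (fun k => uq _) (fun k => ud _).
have /andP[_ h2] :=
  weak (fun k => u k.+2) (fun k => u0 _) (fun k => uq _) (fun k => ud _).
have e1 := lim_recl u u0 uq.
have e2 := lim_recl (fun k => u k.+1) (fun k => u0 _) (fun k => uq _).
have := ud 0%N; have := ud 1%N; lra.
Unshelve. all: by end_near. Qed.

End alternating_series.

(** * Existence and uniqueness of first zeros *)

Section first_zero.
Set Implicit Arguments.
Unset Strict Implicit.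
Variable R : realType.
Implicit Types (f : R -> R) (a b : R) (p : {poly R}).

(** The zeros in the segment form a compact set, nonempty by the intermediate value theorem, so the
    identity attains its minimum there. *)
Lemma exists_first_zero f a b : a <= b -> {within `[a, b], continuous f} ->
  0 <= f a -> f b <= 0 ->
  exists r, [/\ a <= r <= b, f r = 0 &
                forall x, a <= x <= b -> f x = 0 -> r <= x].
Proof.
move=> ab cf fa fb.
have [c cab fc] : exists2 c, c \in `[a, b] & f c = 0.
  by apply: IVT => //; rewrite ge_min le_max fa fb orbT.
(* Continuity within the segment makes the zero set closed only in the subspace topology; [V] is a
   closed subset of the line with the same trace on the segment. *)
have /closed_subspaceP[V cV VE] : closed (f @^-1` [set 0] : set (subspace `[a, b])).
  by move: cf => /continuous_closedP; apply; exact: closed_eq.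
have memV x : V x /\ x \in `[a, b] <-> f x = 0 /\ x \in `[a, b].
  by have /seteqP[h1 h2] := VE; split => [/h1|/h2].
have cpt : compact (V `&` `[a, b]).
  by rewrite setIC; apply: compact_closedI => //; exact: segment_compact.
have [||r] := @compact_EVT_min _ _ (fun x : R => x) _ _ cpt.
- by exists c; exact/memV.
- by apply: continuous_subspaceT => x; exact: cvg_id.
rewrite inE => /memV[fr rab] rmin; exists r; split => //.
move=> x xab fx; apply: rmin; rewrite inE; exact/memV.
Qed.

(** Otherwise [f] would have a zero in [[0, x]], positive because [0 < f 0], and smaller than
    [r]. *)
Lemma is_first_posroot_gt0 f r x : {within `[0, r], continuous f} ->
  is_first_posroot f r -> 0 < f 0 -> 0 <= x < r -> 0 < f x.
Proof.
move=> cf [r0 _ rmin] f0 /andP[x0 xr]; rewrite ltNge; apply/negP => fx.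
have [|c [/andP[c0 cx] fc _]] := @exists_first_zero f 0 x x0 _ (ltW f0) fx.
  apply: continuous_subspaceW cf; apply: subset_itvl.
  by rewrite bnd_simp ltW.
have c_gt0 : 0 < c.
  by rewrite lt_neqAle c0 andbT; apply: contraTneq f0 => c0E; rewrite c0E fc -c0E ltxx.
by have := rmin _ c_gt0 fc; rewrite leNgt (le_lt_trans cx).
Qed.

Lemma exists_first_posroot_poly p b : 0 < b -> 0 < p.[0] -> p.[b] <= 0 ->
  exists2 r, is_first_posroot (horner p) r & r <= b.
Proof.
move=> b0 p0 pb.
have [|r [/andP[r0 rb] pr rmin]] := @exists_first_zero (horner p) 0 b (ltW b0) _ (ltW p0) pb.
  by apply: continuous_subspaceT; exact: continuous_horner.
exists r => //; split => //.
  by rewrite lt_neqAle r0 andbT; apply: contraTneq p0 => r0E; rewrite r0E pr -r0E ltxx.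
move=> x x0 px; have [xb|/ltW] := leP x b; last exact: le_trans.
by apply: rmin => //; rewrite ltW.
Qed.

Lemma is_first_posroot_uniq f r r' :
  is_first_posroot f r -> is_first_posroot f r' -> r = r'.
Proof.
move=> [r0 fr rmin] [r'0 fr' r'min].
by apply/eqP; rewrite eq_le rmin// r'min.
Qed.

(** [xget] returns some first positive root as soon as one exists; uniqueness identifies it with
    [r]. *)
Lemma rfirstE (alpha : R) n r :
  is_first_posroot (horner (pfin alpha n)) r -> rfirst alpha n = r.
Proof.
move=> rr; have := xgetPex 0 (ex_intro _ r rr).
by move=> /is_first_posroot_uniq; apply.
Qed.

End first_zero.

(** * The coefficients and their ratios *)

Section coefficients.
Set Implicit Arguments.
Unset Strict Implicit.
Variables (R : realType) (alpha : R).
Hypothesis alpha01 : 0 < alpha <= 1.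

Let c (i : nat) := Gamma (2 * i%:R + 1 - alpha) / Gamma (2 * i%:R + 2).

Lemma gamma_ratio_gt0 i : (0 < i)%N -> 0 < c i.
Proof.
have /andP[a0 a1] := alpha01.
move=> i0; have i1 : 1 <= i%:R :> R by rewrite ler1n.
by rewrite divr_gt0// Gamma_gt0//; lra.
Qed.

(** With y = 2i+1-alpha and z = 2i+2, the functional equation used twice gives c_(i+1) / c_i =
    (y+1)y / ((z+1)z), which is below 1 since 0 < y < z. *)
Lemma gamma_ratio_decr i : (0 < i)%N -> c i.+1 < c i.
Proof.
have /andP[a0 a1] := alpha01.
move=> i0; have i1 : 1 <= i%:R :> R by rewrite ler1n.
rewrite -[ltRHS]mul1r.
have -> : c i.+1 = (2 * i%:R + 1 - alpha + 1) * (2 * i%:R + 1 - alpha) /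
    ((2 * i%:R + 2 + 1) * (2 * i%:R + 2)) * c i.
  rewrite /c -[i.+1%:R]natr1.
  rewrite (_ : 2 * (i%:R + 1) + 1 - alpha = 2 * i%:R + 1 - alpha + 2); last by ring.
  rewrite (_ : 2 * (i%:R + 1) + 2 = 2 * i%:R + 2 + 2 :> R); last by ring.
  rewrite (@GammaD2 R (2 * i%:R + 1 - alpha)) 1?(@GammaD2 R (2 * i%:R + 2)); [|lra..].
  have := @Gamma_gt0 _ (2 * i%:R + 2) ltac:(lra).
  move: (Gamma _) (Gamma _) => g g' g'0.
  by field; rewrite gt_eqF//=; do ?[apply/andP; split]; rewrite gt_eqF//; lra.
rewrite ltr_pM2r ?gamma_ratio_gt0// ltr_pdivrMr; last by nra.
by nra.
Qed.

Lemma gamma_ratio_le i j : (0 < i <= j)%N -> c j <= c i.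
Proof.
move=> /andP[i0]; elim: j => [|j IHj]; first by rewrite leqn0 => /eqP ->.
rewrite leq_eqVlt => /predU1P[->//|]; rewrite ltnS => ij.
apply: le_trans (IHj ij); apply/ltW/gamma_ratio_decr; exact: leq_trans ij.
Qed.

Lemma acoef0 : acoef alpha 0 = 1.
Proof. by rewrite /acoef big_geq. Qed.

Lemma acoefS k : acoef alpha k.+1 = acoef alpha k * c k.+1.
Proof. by rewrite /acoef big_nat_recr. Qed.

Lemma acoef_gt0 k : 0 < acoef alpha k.
Proof.
elim: k => [|k IHk]; first by rewrite acoef0.
by rewrite acoefS mulr_gt0// gamma_ratio_gt0.
Qed.

Lemma horner_pfin n x : (pfin alpha n).[x] =
  \sum_(0 <= k < n.+1) (-1) ^+ k * (acoef alpha k * x ^+ k).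
Proof.
by rewrite horner_poly big_mkord; apply: eq_bigr => k _; rewrite mulrA.
Qed.

Lemma horner_pfin0 n : (pfin alpha n).[0] = 1.
Proof.
rewrite horner_pfin big_nat_recl// big1 ?addr0.
  by rewrite !expr0 acoef0 !mulr1.
by move=> k _; rewrite expr0n mulr0 mulr0.
Qed.

Lemma pinfty_alt x : pinfty alpha x =
  limn (series (fun k => (-1) ^+ k * (acoef alpha k * x ^+ k))).
Proof.
rewrite /pinfty /pseries; congr (limn (series _)); apply/funext => k.
by rewrite /scoef mulrA.
Qed.

(** * Remainder estimates and continuity of the power series up to [r] *)

Variables (M : nat) (r : R).
Hypotheses (M0 : (0 < M)%N) (r0 : 0 < r) (cr : c M * r <= 1).

(** The assumption on [c M * r] allows equality, so the ratio is taken one index later: strict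
    decrease of [c] then gives [q < 1], and [q] bounds the ratio of consecutive terms from index [M]
    on. *)
Let q := c M.+1 * r.

Lemma ratio_bound01 : 0 <= q < 1.
Proof.
rewrite mulr_ge0 ?(ltW r0) ?(ltW (gamma_ratio_gt0 _))//= (lt_le_trans _ cr)//.
by rewrite ltr_pM2r// gamma_ratio_decr.
Qed.

Lemma acoef_expr_gt0 k x : 0 < x -> 0 < acoef alpha k * x ^+ k.
Proof. by move=> x0; rewrite mulr_gt0 ?acoef_gt0 ?exprn_gt0. Qed.

Lemma acoef_expr_ratio k x : (M <= k)%N -> 0 < x <= r ->
  acoef alpha k.+1 * x ^+ k.+1 <= q * (acoef alpha k * x ^+ k).
Proof.
move=> Mk /andP[x0 xr].
rewrite acoefS exprSr mulrACA mulrC ler_pM2r ?acoef_expr_gt0//.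
rewrite ler_pM ?(ltW x0) ?(ltW (gamma_ratio_gt0 _))//.
exact: gamma_ratio_le.
Qed.

Lemma cvg_alt_tail n x : (M <= n.+1)%N -> 0 < x <= r ->
  cvgn (series (fun k =>
    (-1) ^+ k * (acoef alpha (n.+1 + k) * x ^+ (n.+1 + k)))).
Proof.
move=> Mn xr; have /andP[x0 _] := xr.
apply: (@cvg_alt_series_geometric _
  (fun k => acoef alpha (n.+1 + k) * x ^+ (n.+1 + k)) _ ratio_bound01) => k.
  exact/ltW/acoef_expr_gt0.
by rewrite addnS; apply: acoef_expr_ratio => //; rewrite (leq_trans Mn)// leq_addr.
Qed.

(** The tail after index [n] is again an alternating series, up to the sign of its first term. The
    sign of the remainder will order [pinfty] and the polynomials; its size will give uniform
    approximation. *)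
Lemma pinfty_pfin_bound n x : (M <= n.+1)%N -> 0 < x <= r ->
  exists2 l, pinfty alpha x = (pfin alpha n).[x] + (-1) ^+ n.+1 * l &
    0 < l < acoef alpha n.+1 * x ^+ n.+1.
Proof.
move=> Mn xr; have /andP[x0 _] := xr.
exists (limn (series (fun k =>
    (-1) ^+ k * (acoef alpha (n.+1 + k) * x ^+ (n.+1 + k))))).
  rewrite pinfty_alt horner_pfin; apply/cvg_lim => //.
  apply: (@cvg_alt_series_shift _ (fun k => acoef alpha k * x ^+ k) n.+1).
  exact: cvg_alt_tail.
have := @lim_alt_series_bound _
  (fun k => acoef alpha (n.+1 + k) * x ^+ (n.+1 + k)) _ ratio_bound01.
rewrite addn0; apply => k; first exact: acoef_expr_gt0.
by rewrite addnS; apply: acoef_expr_ratio => //; rewrite (leq_trans Mn)// leq_addr.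
Qed.

(** These are the absolute values of the terms of a convergent series. *)
Lemma cvg_acoef_expr : acoef alpha n * r ^+ n @[n --> \oo] --> 0.
Proof.
have rr : 0 < r <= r by rewrite r0 lexx.
have := @cvg_alt_series_shift _ (fun k => acoef alpha k * r ^+ k) M.+1 _
  (cvg_alt_tail (leqnSn M) rr).
move=> /cvgP/cvg_series_cvg_0/cvg_norm; rewrite normr0; apply: cvg_trans.
apply: near_eq_cvg; near=> n.
by rewrite normrM normrX normrN1 expr1n mul1r gtr0_norm ?acoef_expr_gt0.
Unshelve. all: by end_near. Qed.

(** An argument with [e / 3]: on []0, r]] the distance from [pinfty] to the polynomial of index [n]
    is less than the first omitted term at [r], a bound independent of the point. *)
Lemma within_continuous_pinfty a : 0 < a ->
  {within `[a, r], continuous (pinfty alpha)}.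
Proof.
move=> a0; apply/subspace_continuousP => x /=; rewrite in_itv/= => /andP[ax xr].
apply/cvgrPdist_lt => e e0.
have e3 : 0 < e / 3 by lra.
have [n [Mn nE]] : exists n, (M <= n)%N /\ acoef alpha n.+1 * r ^+ n.+1 < e / 3.
  have /cvgrPdist_lt/(_ _ e3)[n _ nE] := cvg_acoef_expr.
  exists (maxn M n); rewrite leq_maxl; split => //.
  rewrite (le_lt_trans (ler_norm _))//.
  by rewrite -[X in `|X|]opprK normrN -sub0r nE//= leqW// leq_maxr.
have dist y : 0 < y <= r -> `|pinfty alpha y - (pfin alpha n).[y]| < e / 3.
  move=> yr; have [l -> /andP[l0 ll]] := pinfty_pfin_bound (leqW Mn) yr.
  rewrite addrC addKr normrM normrX normrN1 expr1n mul1r gtr0_norm//.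
  rewrite (lt_trans ll)// (le_lt_trans _ nE)// ler_pM2l ?acoef_gt0//.
  by move: yr => /andP[y0 yr]; rewrite lerXn2r ?nnegrE// ltW.
have := @continuous_horner _ (pfin alpha n) x.
move=> /cvgrPdist_lt/(_ _ e3) cn; rewrite near_withinE.
apply: filterS cn => y xy; rewrite /= in_itv/= => /andP[ay yr].
rewrite (_ : pinfty alpha x - pinfty alpha y = pinfty alpha x - (pfin alpha n).[x] +
  ((pfin alpha n).[x] - (pfin alpha n).[y]) -
  (pinfty alpha y - (pfin alpha n).[y])); last by ring.
rewrite (le_lt_trans (ler_normB _ _))// (le_lt_trans (lerD (ler_normD _ _) (lexx _)))//.
have := dist x; have := dist y; rewrite xr yr !(lt_le_trans a0)// => /(_ isT) + /(_ isT).
by lra.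
Qed.

End coefficients.

(** * Locating the first positive root of the power series *)

Theorem theorem3p5 (R : realType) (alpha : R) (n0 : nat)
    (halpha : 0 < alpha <= 1)
    (hn0_pos : (0 < n0)%N) (hn0_even : ~~ odd n0)
    (hroot : exists2 x : R, 0 < x & root (pfin alpha n0) x)
    (hr : rfirst alpha n0 <=
          Gamma (2 * n0%:R + 6) / Gamma (2 * n0%:R + 5 - alpha)) :
  exists2 r : R, is_first_posroot (pinfty alpha) r &
    rfirst alpha n0.+1 < r < rfirst alpha n0.
Proof.
have p0 n : 0 < (pfin alpha n).[0] by rewrite horner_pfin0.
have [x x0 /eqP px] := hroot.
have [|r rP _] := exists_first_posroot_poly x0 (p0 n0); first by rewrite px.
move: hr; rewrite (rfirstE rP) => {}hr.
have [r0 pr _] := rP.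
(* The hypothesis [hr] in the form [c M * r <= 1] with [M = n0.+2]. *)
have cr : Gamma (2 * n0.+2%:R + 1 - alpha) / Gamma (2 * n0.+2%:R + 2) * r <= 1.
  move: hr; have -> : 2 * n0%:R + 6 = 2 * n0.+2%:R + 2 :> R by rewrite -!natr1; ring.
  have -> : 2 * n0%:R + 5 - alpha = 2 * n0.+2%:R + 1 - alpha by rewrite -!natr1; ring.
  have [g0 g1] : 0 < Gamma (2 * n0.+2%:R + 1 - alpha) /\ 0 < Gamma (2 * n0.+2%:R + 2 : R).
    have := ler0n R n0; case/andP: halpha => a0 a1.
    by split; apply: Gamma_gt0; rewrite -!natr1; lra.
  by rewrite ler_pdivlMr// mulrAC ler_pdivrMr// mul1r mulrC.
pose u k x := acoef alpha k * x ^+ k.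
(* The ratio of these two terms is c_(n0+2) x', at most 1 by [cr]; the geometric decay starts only
   at the next ratio. *)
have u_decr x' : 0 < x' <= r -> u n0.+2 x' <= u n0.+1 x'.
  move=> /andP[x'0 x'r]; rewrite /u acoefS exprSr mulrACA.
  rewrite ler_piMr ?(ltW (acoef_expr_gt0 halpha _ x'0))// (le_trans _ cr)//.
  by rewrite ler_wpM2l// ltW// gamma_ratio_gt0.
have pS x' : (pfin alpha n0.+1).[x'] = (pfin alpha n0).[x'] - u n0.+1 x'.
  rewrite !horner_pfin big_nat_recr//=; congr (_ + _).
  by rewrite exprS -signr_odd (negbTE hn0_even) expr0 mulr1 mulN1r.
have bound x' : 0 < x' <= r ->
    (pfin alpha n0.+1).[x'] < pinfty alpha x' < (pfin alpha n0).[x'].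
  (* Since [n0] is even, the remainder after index [n0.+1] enters with a plus sign. It is positive,
     and less than [u n0.+2 x'], hence than the term [u n0.+1 x'] that separates the two
     polynomials. *)
  move=> x'r; have [l -> /andP[l0 lu]] :=
    pinfty_pfin_bound halpha (ltn0Sn n0.+1) r0 cr (leqnn n0.+2) x'r.
  rewrite -signr_odd /= negbK (negbTE hn0_even) expr0 mul1r ltrDl l0/= pS.
  have := u_decr _ x'r; move: lu; rewrite -/(u n0.+2 x'); lra.
have rr : 0 < r <= r by rewrite r0 lexx.
(* At [r] the polynomial of index [n0.+1] equals [- u n0.+1 r], so its first root is at most [r]. *)
have [|s sP sr] := exists_first_posroot_poly r0 (p0 n0.+1).
  by rewrite pS pr sub0r oppr_le0 mulr_ge0// ?exprn_ge0 ?(ltW r0)// ltW// acoef_gt0.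
rewrite (rfirstE sP); have [s0 ps _] := sP.
have srr : 0 < s <= r by rewrite s0.
have pinf_s : 0 < pinfty alpha s by have /andP[+ _] := bound _ srr; rewrite ps.
have pinf_r : pinfty alpha r < 0 by have /andP[_ +] := bound _ rr; rewrite pr.
have [t [/andP[st tr] pt tmin]] := exists_first_zero sr
  (within_continuous_pinfty halpha (ltn0Sn n0.+1) r0 cr s0) (ltW pinf_s) (ltW pinf_r).
exists t; last first.
  rewrite !lt_neqAle st tr !andbT; apply/andP; split.
    by apply/eqP => tE; move: pinf_s; rewrite tE pt ltxx.
  by apply/eqP => tE; move: pinf_r; rewrite -tE pt ltxx.
split => //; first exact: lt_le_trans st.
(* A positive zero [y] lies beyond [r], or in [[s, r]] where [t] is minimal, or before [s]. The last
   case is impossible: there the polynomial of index [n0.+1] is positive and bounds [pinfty] from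
   below. *)
move=> y y0 py; have [yr|/ltW] := leP y r; last exact: le_trans.
have [sy|ys] := leP s y; first by apply: tmin => //; rewrite sy.
have : 0 < (pfin alpha n0.+1).[y].
  apply: (is_first_posroot_gt0 _ sP (p0 _)); last by rewrite ltW.
  by apply: continuous_subspaceT; exact: continuous_horner.
have /andP[+ _] := bound y ltac:(by rewrite y0 yr).
by rewrite py => /lt_trans/[apply]; rewrite ltxx.
Qed.
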